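(* Let $d,k\ge 1$ be integers and let $v\in\mathbb{R}^d$. (1) If $\mathcal{S}=(S_1,\ldots,S_{d+k})$ is a family of subsets of $\mathbb{R}^d$ such that $v\in \mathrm{conv}\left(\bigcup_{i\in K}S_i\right)$ for every $K\subseteq\{1,\ldots,d+k\}$ of size $k$, then there exists an $\mathcal{S}$-rainbow set $S$ such that $v\in \mathrm{conv}(S)$. (2) If $\mathcal{S}=(S_1,\ldots,S_{d+k-1})$ is a family of subsets of $\mathbb{R}^d$ such that $v\in \mathrm{cone}\left(\bigcup_{i\in K}S_i\right)$ for every $K\subseteq\{1,\ldots,d+k-1\}$ of size $k$, then there exists an $\mathcal{S}$-rainbow set $S$ such that $v\in \mathrm{cone}(S)$.
   Context: ''Family'' means multiset: members may repeat. $\mathrm{conv}(A)$ is the convex hull of $A$, and $\mathrm{cone}(A)$ is the set of (finite) non-negative linear combinations of elements of $A$. For a family $\mathcal{S}=(S_1,\dots,S_m)$ of sets, an $\mathcal{S}$-rainbow set is the image of a partial choice function of $\mathcal{S}$, i.e. a set $\{x_{i_j}\mid j\le r\}$ where $1\le i_1<\dots<i_r\le m$ and $x_{i_j}\in S_{i_j}$. *)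

(* Defs.v *)
From mathcomp Require Import all_boot all_order all_algebra.
From mathcomp Require Import all_classical all_reals convex.

Set Implicit Arguments.
Unset Strict Implicit.
Unset Printing Implicit Defensive.

Import Order.TTheory GRing.Theory Num.Theory.

Local Open Scope classical_set_scope.
Local Open Scope ring_scope.

Definition conv_hull (R : realType) (V : lmodType R) (A : set V) : set V :=
  smallest (@convex_set R V) A.

(* The case [n = 0] is allowed, so [0] always belongs to [conic_hull A]. *)
Definition conic_hull (R : realType) (V : lmodType R) (A : set V) : set V :=
  [set v | exists (n : nat) (a : 'I_n -> R) (x : 'I_n -> V),
    [/\ forall i, 0 <= a i,
        forall i, A (x i)
      & v = \sum_(i < n) a i *: x i]].

(* [f] is a partial choice function ([f i = None] when no element of [S i] is
   chosen) and [X] is its image; the nowhere-defined [f] is allowed. *)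
Definition rainbow_set (T : Type) (m : nat) (S : 'I_m -> set T) (X : set T) :
    Prop :=
  exists f : 'I_m -> option T,
    (forall i x, f i = Some x -> S i x) /\
    X = [set x | exists i, f i = Some x].

(* Main.v *)
(* Conic case: finitely many points suffice to witness the hypotheses.  Among
   the linearly independent rainbow sets J such that the orthogonal projection p
   of v on the span of J lies in cone(J), take one minimizing |v - p|.  If
   p <> v, then J lies in the hyperplane orthogonal to v - p, so |J| < d and at
   least k colours are unused; as v is in the cone of these colours and
   <v - p, v> > 0, one of their points y has <v - p, y> > 0.  Moving p slightly
   towards y gets closer to v inside cone(J + y), and a subset of J + y then
   contradicts minimality.
   The convex case in dimension d is the conic case in dimension d + 1, after
   replacing each point x by (x, 1). *)

Require Import Defs.
From mathcomp Require Import all_boot all_order all_algebra.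
From mathcomp Require Import all_classical all_reals.
From mathcomp Require Import convex interval_inference zify ring lra.

Set Implicit Arguments.
Unset Strict Implicit.
Unset Printing Implicit Defensive.

Import Order.TTheory GRing.Theory Num.Theory.

Local Open Scope classical_set_scope.
Local Open Scope ring_scope.

(** * The standard inner product on row vectors *)

Section DotProduct.
Context {R : realType} {d : nat}.
Implicit Types (u v w : 'rV[R]_d) (a : R).

Definition dot u w : R := \sum_j u 0 j * w 0 j.

Lemma dotC u w : dot u w = dot w u.
Proof. by apply: eq_bigr => j _; rewrite mulrC. Qed.

Lemma dotDr u v w : dot u (v + w) = dot u v + dot u w.
Proof. by rewrite -big_split; apply: eq_bigr => j _; rewrite mxE mulrDr. Qed.

Lemma dotZr u a w : dot u (a *: w) = a * dot u w.
Proof. by rewrite mulr_sumr; apply: eq_bigr => j _; rewrite mxE mulrCA. Qed.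

Lemma dotBr u v w : dot u (v - w) = dot u v - dot u w.
Proof. by rewrite -scaleN1r dotDr dotZr mulN1r. Qed.

Lemma dot0r u : dot u 0 = 0.
Proof. by rewrite -(scale0r 0) dotZr mul0r. Qed.

Lemma dotDl u v w : dot (u + v) w = dot u w + dot v w.
Proof. by rewrite dotC dotDr !(dotC w). Qed.

Lemma dotZl a u w : dot (a *: u) w = a * dot u w.
Proof. by rewrite dotC dotZr dotC. Qed.

Lemma dotBl u v w : dot (u - v) w = dot u w - dot v w.
Proof. by rewrite dotC dotBr !(dotC w). Qed.

Lemma dot_sqrD u w :
  dot (u + w) (u + w) = dot u u + 2 * dot u w + dot w w.
Proof. by rewrite dotDl !dotDr (dotC w u); ring. Qed.

Lemma dot_sumr (I : finType) u (F : I -> 'rV[R]_d) :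
  dot u (\sum_e F e) = \sum_e dot u (F e).
Proof. exact: (big_morph _ (dotDr u) (dot0r u)). Qed.

Lemma dot_ge0 u : 0 <= dot u u.
Proof. by apply: sumr_ge0 => j _; rewrite -expr2 sqr_ge0. Qed.

Lemma dot_eq0 u : dot u u = 0 -> u = 0.
Proof.
move=> u0; apply/rowP => j; rewrite mxE.
have /psumr_eq0P/(_ u0 j isT)/eqP : forall j, true -> 0 <= u 0 j * u 0 j.
  by move=> i _; rewrite -expr2 sqr_ge0.
by rewrite mulf_eq0 orbb => /eqP.
Qed.

Lemma dot_gt0 u : u != 0 -> 0 < dot u u.
Proof.
move=> u0; rewrite lt_def dot_ge0 andbT.
by apply: contra_neq u0; exact: dot_eq0.
Qed.

End DotProduct.

(** * Projections onto spans, and non-negative least squares *)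

Section LeastSquares.
Context {R : realType} {d : nat} {I : finType}.
Variable x : I -> 'rV[R]_d.
Implicit Types (c b : I -> R) (J : {set I}) (u v w : 'rV[R]_d) (e : I).

Definition lin c : 'rV[R]_d := \sum_e c e *: x e.

(** Coefficients are functions on all of [I] that vanish off [J], so that index sets can grow or
    shrink without reindexing. *)
Definition supported J c : Prop := forall e, e \notin J -> c e = 0.

Definition orthogonal_on J u : Prop := forall e, e \in J -> dot u (x e) = 0.

Definition independent_on J : Prop :=
  forall c, supported J c -> lin c = 0 -> forall e, c e = 0.

Lemma linD c b (t : R) : lin (fun e => c e + t * b e) = lin c + t *: lin b.
Proof.
rewrite scaler_sumr -big_split; apply: eq_bigr => e _.
by rewrite scalerDl scalerA.
Qed.

Lemma lin_delta e : lin (fun e' => (e' == e)%:R) = x e.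
Proof.
rewrite /lin (bigD1 e) //= eqxx scale1r big1 ?addr0 // => e' /negPf ->.
by rewrite scale0r.
Qed.

Lemma dot_lin u c : dot u (lin c) = \sum_e c e * dot u (x e).
Proof. by rewrite dot_sumr; apply: eq_bigr => e _; rewrite dotZr. Qed.

Lemma supportedS J J' c : J \subset J' -> supported J c -> supported J' c.
Proof.
by move=> sJ cJ e eJ; apply: cJ; apply: contra eJ; exact/fintype.subsetP.
Qed.

Lemma independent_onS J J' :
  J \subset J' -> independent_on J' -> independent_on J.
Proof. by move=> sJ iJ c cJ; apply: iJ; apply: supportedS cJ. Qed.

Lemma dot_lin_orthogonal J u c :
  orthogonal_on J u -> supported J c -> dot u (lin c) = 0.
Proof.
move=> uJ cJ; rewrite dot_lin big1 // => e _.
by have [/uJ ->|/cJ ->] := boolP (e \in J); rewrite ?mulr0 ?mul0r.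
Qed.

(** Gram-Schmidt by induction on [#|J|]: remove [e0], project both [w] and [x e0] on the remaining
    span, then correct along the residual of [x e0]. *)
Lemma projection_exists J w :
  exists2 c, supported J c & orthogonal_on J (w - lin c).
Proof.
have [n] := ubnP #|J|; elim: n => // n IHn in J w *; rewrite ltnS => Jn.
have [->|[e0 e0J]] := set_0Vmem J.
  by exists (fun _ => 0) => // e; rewrite inE.
have J'n : (#|J :\ e0| < n)%N.
  by apply: leq_trans Jn; rewrite [X in (_ < X)%N](cardsD1 e0) e0J.
have [c cJ rJ] := IHn _ w J'n; have [b bJ uJ] := IHn _ (x e0) J'n.
set r := w - lin c in rJ; set u := x e0 - lin b in uJ.
have rb : dot r (lin b) = 0 by apply: dot_lin_orthogonal bJ.
have ub : dot u (lin b) = 0 by apply: dot_lin_orthogonal bJ.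
(* If [u = 0], then [x e0] is in the span of the other points and [c] already works. *)
have [u0|u_neq0] := eqVneq u 0.
  exists c => [e eJ|e eJ]; first by apply: cJ; rewrite !inE (negPf eJ) andbF.
  have [->|ee0] := eqVneq e e0; last by apply: rJ; rewrite !inE ee0.
  by move/eqP: u0; rewrite subr_eq0 => /eqP ->.
(* As [dot u (x e0) = dot u u], this makes [r - t *: u] orthogonal to [x e0]. *)
pose t := dot r (x e0) / dot u u.
exists (fun e => c e + t * ((e == e0)%:R + (-1) * b e)) => [e eJ|].
  have ee0 : e == e0 = false by apply/negbTE; apply: contraNneq eJ => ->.
  by rewrite ee0 cJ ?bJ ?inE ?(negPf eJ) ?andbF //; rewrite mulr0n; ring.
have -> : w - lin (fun e => c e + t * ((e == e0)%:R + (-1) * b e))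
    = r - t *: u.
  by rewrite !linD lin_delta scaleN1r opprD addrA.
move=> e eJ; rewrite dotBl dotZl.
have [->|ee0] := eqVneq e e0; last by rewrite rJ ?uJ ?inE ?ee0 //; ring.
have <- : dot u u = dot u (x e0) by rewrite [in LHS]/u dotBr -/u ub subr0.
by rewrite /t divfK ?subrr // gt_eqF // dot_gt0.
Qed.

(** Pythagoras: [lin c - lin b] is orthogonal to the residual [v - lin c]. *)
Lemma projection_min J c b v :
    supported J c -> supported J b -> orthogonal_on J (v - lin c) ->
  dot (v - lin c) (v - lin c) <= dot (v - lin b) (v - lin b).
Proof.
move=> cJ bJ rJ; set r := v - lin c in rJ *.
pose w := lin c - lin b.
have rw : dot r w = 0.
  by rewrite (dotBr _ (lin c)) !(dot_lin_orthogonal rJ) // subrr.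
have -> : v - lin b = r + w by rewrite subrKA.
by rewrite dot_sqrD rw mulr0 addr0 lerDl dot_ge0.
Qed.

(* Inner loop of the Lawson-Hanson algorithm: while the projection of [v] on the
   span of [J] has a negative coefficient, slide from the current point towards
   it until a coefficient vanishes, and discard that index. *)
Lemma descend_to_projection J c v :
    supported J c -> (forall e, 0 <= c e) ->
  exists J' c', [/\ J' \subset J, supported J' c', forall e, 0 <= c' e,
    orthogonal_on J' (v - lin c')
    & dot (v - lin c') (v - lin c') <= dot (v - lin c) (v - lin c)].
Proof.
have [n] := ubnP #|J|; elim: n => // n IHn in J c *; rewrite ltnS => Jn cJ c0.
have [b bJ rJ] := projection_exists J v.
have [b0|] := pselect (forall e, 0 <= b e).
  by exists J, b; split => //; apply: (projection_min (J := J)).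
move=> /existsNP[e1 /negP]; rewrite -ltNge => be1.
(* On the segment from [c] to [b], coordinate [e] vanishes at parameter [s e]; stopping at the least
   [s e] with [b e < 0] keeps all coordinates non-negative. *)
pose s e := c e / (c e - b e).
case: (@arg_minP _ _ _ e1 (fun e => b e < 0) s be1) => e0 /= be0 smin.
have den e : b e < 0 -> 0 < c e - b e.
  by move=> be; have := c0 e; lra.
have e0J : e0 \in J by apply: contraTT be0 => /bJ ->; rewrite ltxx.
have t0 : 0 <= s e0 by rewrite divr_ge0 // ltW // den.
have t1 : s e0 <= 1 by rewrite ler_pdivrMr ?den //; lra.
pose c' e := c e + s e0 * (b e + (-1) * c e).
have c'0 e : 0 <= c' e.
  rewrite /c'; have := c0 e; have [be ce|be ce] := ltP (b e) 0; last by nra.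
  have := smin _ be; rewrite {2}/s ler_pdivlMr ?den // => h; nra.
have c'J : supported (J :\ e0) c'.
  move=> e; rewrite !inE negb_and negbK /c' => /orP[/eqP ->|eJ].
    by rewrite /s; have := den _ be0 => h; field; rewrite gt_eqF.
  by rewrite cJ // bJ //; ring.
have [|J' [c'' [sJ' c''J c''0 orth le]]] := IHn _ _ _ c'J c'0.
  by apply: leq_trans Jn; rewrite [X in (_ < X)%N](cardsD1 e0) e0J.
exists J', c''; split => //.
  exact: fintype.subset_trans sJ' (finset.subsetDl _ _).
apply: le_trans le _.
(* The move keeps the component [r] of the residual and scales the orthogonal component [w] by
   [1 - s e0], which lies in [0, 1]. *)
set r := v - lin b in rJ *; pose w := lin b - lin c.
have rw : dot r w = 0.
  by rewrite (dotBr _ (lin b)) !(dot_lin_orthogonal rJ) // subrr.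
have -> : v - lin c' = r + (1 - s e0) *: w.
  rewrite /c' !linD scaleN1r -/w scalerBl scale1r /r /w.
  by rewrite addrA subrKA opprD addrA.
have -> : v - lin c = r + w by rewrite subrKA.
rewrite (dot_sqrD r (_ *: w)) (dot_sqrD r w) !(dotZl, dotZr) rw.
have s2 : 0 <= s e0 * (2 - s e0) by apply: mulr_ge0 => //; lra.
have := mulr_ge0 (dot_ge0 w) s2; lra.
Qed.

(** Pairing a vanishing combination with [u] leaves only the term of [e], so its coefficient is
    zero. *)
Lemma independent_onU1 J e u : independent_on J -> orthogonal_on J u ->
  dot u (x e) != 0 -> independent_on (e |: J).
Proof.
move=> iJ uJ ue c cJ lc.
have ce : c e = 0.
  have := dot_lin u c; rewrite lc dot0r (bigD1 e) //= big1 => [|e' ee'].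
    by move/esym/eqP; rewrite addr0 mulf_eq0 (negPf ue) orbF => /eqP.
  have [/uJ ->|eJ] := boolP (e' \in J); first by rewrite mulr0.
  by rewrite cJ ?mul0r // !inE (negPf ee') (negPf eJ).
apply: iJ => // e' eJ; have [-> //|ee'] := eqVneq e' e.
by apply: cJ; rewrite !inE (negPf ee') (negPf eJ).
Qed.

(** The points of [J] are the rows of a matrix of rank [#|J|] that kills the nonzero column
    [u^T]. *)
Lemma card_independent_orthogonal J u :
  independent_on J -> orthogonal_on J u -> u != 0 -> (#|J| < d)%N.
Proof.
move=> iJ uJ u0.
pose B := \matrix_(i < #|J|) x (enum_val i).
have Bfree : row_free B.
  rewrite -kermx_eq0; apply/rowV0P => a /sub_kermxP aB.
  (* A sum with at most one term, which carries the row coefficients [a] over to [I]. *)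
  pose c e := \sum_(i | enum_val i == e) a 0 i.
  have c_val i : c (enum_val i) = a 0 i.
    rewrite /c (eq_bigl (pred1 i)) ?big_pred1_eq // => j.
    by rewrite (inj_eq enum_val_inj).
  have cJ : supported J c.
    move=> e eJ; rewrite /c big_pred0 // => i.
    by apply: contraNF eJ => /eqP <-; apply: enum_valP.
  apply/rowP => i; rewrite mxE -c_val; apply: iJ => //.
  transitivity (a *m B); last by [].
  rewrite mulmx_sum_row /lin (bigID (mem J)) /= addrC big1 ?add0r.
    by rewrite big_enum_val; apply: eq_bigr => j _; rewrite c_val rowK.
  by move=> e /cJ ->; rewrite scale0r.
have Bu : B *m u^T = 0.
  apply/matrixP => i j; rewrite ord1 !mxE -[RHS](uJ _ (enum_valP i)).
  by apply: eq_bigr => l _; rewrite !mxE mulrC.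
have := mulmx0_rank_max Bu.
by rewrite (eqP Bfree) mxrank_tr rank_rV u0 addn1.
Qed.

End LeastSquares.

(** * The conic case for finitely many coloured points *)

Lemma subset_of_card (T : finType) (A : {set T}) (k : nat) :
  (k <= #|A|)%N -> exists2 B : {set T}, B \subset A & #|B| = k.
Proof.
move=> /card_geqP[s [s_uniq s_size sA]]; exists [set z in s].
  by apply/fintype.subsetP => z; rewrite inE => /sA.
by rewrite cardsE (card_uniqP s_uniq).
Qed.

Lemma colorful_lin (R : realType) (d k m : nat) (I : finType)
    (x : I -> 'rV[R]_d) (col : I -> 'I_m) (v : 'rV[R]_d) :
    (d + k <= m.+1)%N ->
    (forall K : {set 'I_m}, #|K| = k -> exists a : I -> R,
      [/\ forall e, 0 <= a e, supported [set e | col e \in K] a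
        & v = lin x a]) ->
  exists (J : {set I}) (a : I -> R), [/\ {in J &, injective col},
    forall e, 0 <= a e, supported J a & v = lin x a].
Proof.
move=> dkm Hv.
pose cand (J : {set I}) (a : I -> R) (r : R) := [/\ independent_on x J,
  forall e, 0 <= a e, supported J a, orthogonal_on x J (v - lin x a)
  & r = dot (v - lin x a) (v - lin x a)].
pose good (J : {set I}) :=
  `[< {in J &, injective col} /\ exists r a, cand J a r >].
(* All candidates for one [J] give the same value, by minimality of projections; the default 0 never
   occurs for a good [J]. *)
pose dist (J : {set I}) := xget 0 [set r | exists a, cand J a r].
have distP J : good J -> exists a, cand J a (dist J).
  move=> /asboolP[_ ex_r].
  exact: (@xgetPex _ 0 [set r | exists a, cand J a r]).
have good0 : good finset.set0.
  apply/asboolP; split; first by move=> e e'; rewrite inE.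
  exists (dot (v - lin x (fun=> 0)) (v - lin x (fun=> 0))), (fun=> 0).
  split => // [c cJ _ e|e]; last by rewrite inE.
  by apply: cJ; rewrite inE.
case: (@arg_minP _ _ _ finset.set0 good dist good0) => J gJ Jmin.
have /asboolP[col_inj _] := gJ.
have [c [iJ c0 cJ rJ distJ]] := distP _ gJ.
exists J, c; split => //; apply/eqP; rewrite -subr_eq0.
apply: contraT => r_neq0; exfalso.
set r := v - lin x c in rJ distJ r_neq0.
(* [J] uses at most [d - 1] of the [m >= d + k - 1] colours, so [k] colours remain. *)
have [K KJ Kk] : exists2 K : {set 'I_m}, K \subset ~: (col @: J) & #|K| = k.
  apply: subset_of_card; rewrite cardsCs finset.setCK card_ord.
  have Jd : (#|J| < d)%N by apply: card_independent_orthogonal iJ rJ r_neq0.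
  have imJ : (#|col @: J| <= #|J|)%N by exact: leq_imset_card.
  move: dkm imJ Jd; move: #|J| #|_| => p q; lia.
have [a [a0 aK va]] := Hv K Kk.
(* Since [r] is orthogonal to [lin x c], [dot r v = dot r r > 0], so some term of the combination
   giving [v] pairs positively with [r]. *)
have [e re] : exists e, 0 < a e * dot r (x e).
  apply/not_existsP => nre.
  have : 0 < dot r v.
    rewrite -[X in dot _ X](subrK (lin x c)) dotDr.
    by rewrite (dot_lin_orthogonal rJ cJ) addr0 dot_gt0.
  rewrite va dot_lin ltNge => /negP; apply; apply: sumr_le0 => e _.
  by rewrite leNgt; apply/negP; apply: nre.
have ae : a e != 0 by apply: contraTneq re => ->; rewrite mul0r ltxx.
have colK : col e \in K.
  by apply: contraNT ae => eK; rewrite aK ?inE.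
have {}re : 0 < dot r (x e) by rewrite pmulr_rgt0 // lt_def ae a0 in re.
have xe0 : 0 < dot (x e) (x e).
  by apply: dot_gt0; apply: contraTneq re => ->; rewrite dot0r ltxx.
(* The minimizer of the squared norm of [r - s *: x e], which drops by [s ^ 2 * dot (x e) (x e)]. *)
pose s := dot r (x e) / dot (x e) (x e).
have s0 : 0 < s by rewrite divr_gt0.
pose c1 e' := c e' + s * (e' == e)%:R.
have c1J : supported (e |: J) c1.
  move=> e'; rewrite !inE negb_or => /andP[/negPf ee' eJ].
  by rewrite /c1 ee' cJ // mulr0 addr0.
have c10 e' : 0 <= c1 e' by rewrite addr_ge0 // mulr_ge0 // ltW.
have c1_lt : dot (v - lin x c1) (v - lin x c1) < dot r r.
  have -> : v - lin x c1 = r + (- s) *: x e.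
    by rewrite linD lin_delta opprD addrA scaleNr.
  rewrite (dot_sqrD r (_ *: _)) !(dotZl, dotZr).
  have : dot r (x e) = s * dot (x e) (x e) by rewrite divfK // gt_eqF.
  move=> ->; have := mulr_gt0 (mulr_gt0 s0 s0) xe0; lra.
have [J' [c' [sJ' c'J' c'0 orth le]]] := descend_to_projection x v c1J c10.
have iJ' : independent_on x J'.
  apply: independent_onS sJ' _.
  by apply: independent_onU1 iJ rJ _; rewrite gt_eqF.
have gJ' : good J'.
  apply/asboolP; split; last first.
    by exists (dot (v - lin x c') (v - lin x c')), c'.
  have eJ e' : e' \in J -> col e <> col e'.
    move=> e'J ee'; have := fintype.subsetP KJ _ colK.
    by rewrite inE ee' imset_f.
  have inj : {in e |: J &, injective col}.
    move=> e1 e2; rewrite !inE => /orP[/eqP ->|e1J] /orP[/eqP ->|e2J] //.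
    - by move=> ee2; case: (eJ _ e2J).
    - by move=> /esym ee1; case: (eJ _ e1J).
    - exact: col_inj.
  by apply: sub_in2 inj => e'; apply: (fintype.subsetP sJ').
have [c'' [_ _ c''J' orth'' dist'']] := distP _ gJ'.
(* [dist J'] is computed from [c''], which is at least as close to [v] as [c'] and hence strictly
   closer than [c]. *)
have := Jmin _ gJ'; rewrite distJ dist''.
have := projection_min c''J' c'J' orth''.
move=> h1 h2; have := le_lt_trans (le_trans h2 (le_trans h1 le)) c1_lt.
by rewrite ltxx.
Qed.

(** * Closure properties of conic hulls *)

Section ConicHull.
Context {R : realType} {V : lmodType R}.
Implicit Types (A : set V) (v w : V).

Lemma sub_conic_hull A : A `<=` conic_hull A.
Proof.
move=> w Aw; exists 1%N, (fun=> 1), (fun=> w).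
by split => //; rewrite big_ord1 scale1r.
Qed.

Lemma conic_hull0 A : conic_hull A 0.
Proof.
exists 0%N, (fun=> 0), (fun=> 0).
by split => [||]; [case|case|rewrite big_ord0].
Qed.

Lemma conic_hullD A v w :
  conic_hull A v -> conic_hull A w -> conic_hull A (v + w).
Proof.
move=> [n [a [x [a0 xA ->]]]] [p [b [y [b0 yA ->]]]].
exists (n + p)%N.
exists (fun i => match fintype.split i with inl j => a j | inr j => b j end).
exists (fun i => match fintype.split i with inl j => x j | inr j => y j end).
split => [i|i|]; try by case: fintype.split.
rewrite big_split_ord /=; congr (_ + _); apply: eq_bigr => i _.
  by have /= -> := unsplitK (inl i : 'I_n + 'I_p).
by have /= -> := unsplitK (inr i : 'I_n + 'I_p).
Qed.

Lemma conic_hullZ A t w : 0 <= t -> conic_hull A w -> conic_hull A (t *: w).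
Proof.
move=> t0 [n [a [x [a0 xA ->]]]]; exists n, (fun i => t * a i), x.
split => // [i|]; first exact: mulr_ge0.
by rewrite scaler_sumr; apply: eq_bigr => i _; rewrite scalerA.
Qed.

End ConicHull.

(** * The conic case for arbitrary sets *)

Lemma rainbow_conic_hull (R : realType) (d k m : nat) (v : 'rV[R]_d)
    (S : 'I_m -> set 'rV[R]_d) :
    (d + k <= m.+1)%N ->
    (forall K : {set 'I_m}, #|K| = k ->
      conic_hull (\bigcup_(i in [set` K]) S i) v) ->
  exists X, rainbow_set S X /\ conic_hull X v.
Proof.
move=> dkm Hv.
have /choice[P HP] (K : {set 'I_m}) :
    exists p : {n : nat & 'I_n -> R * 'rV[R]_d * 'I_m},
      (forall i, [/\ 0 <= (projT2 p i).1.1, (projT2 p i).2 \in K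
                   & S (projT2 p i).2 (projT2 p i).1.2]) /\
      (#|K| = k -> v = \sum_i (projT2 p i).1.1 *: (projT2 p i).1.2).
  have [/Hv [n [a [x [a0 xS ->]]]]|nK] := pselect (#|K| = k); last first.
    (* For sizes other than [k] the empty combination serves as a placeholder, so [P] is defined on
       every [K]. *)
    have f0 : 'I_0 -> R * 'rV[R]_d * 'I_m by case.
    by exists (existT _ 0%N f0); split => // -[].
  have /choice[col Hcol] i : exists z, z \in K /\ S z (x i).
    by have [z zK Sz] := xS i; exists z.
  exists (existT _ n (fun i => (a i, x i, col i))); split => //= i.
  by have [] := Hcol i.
(* An index is a set [K] together with a term of the conic combination chosen
   for [K]; finitely many points thus witness all the hypotheses. *)
pose I := {K : {set 'I_m} & 'I_(projT1 (P K))}.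
pose pt (e : I) := projT2 (P (tag e)) (tagged e).
have ptP (e : I) : [/\ 0 <= (pt e).1.1, (pt e).2 \in tag e
    & S (pt e).2 (pt e).1.2].
  by have [/(_ (tagged e))] := HP (tag e).
pose x e := (pt e).1.2; pose col e := (pt e).2.
have Hlin (K : {set 'I_m}) : #|K| = k -> exists a : I -> R,
    [/\ forall e, 0 <= a e, supported [set e | col e \in K] a & v = lin x a].
  move=> Kk; exists (fun e : I => if tag e == K then (pt e).1.1 else 0).
  split => [e|e|].
  - by case: ifP => // _; have [] := ptP e.
  - rewrite inE; case: ifP => // /eqP <-; have [_ eK _] := ptP e.
    by rewrite eK.
  - transitivity (\sum_(K' | K' == K)
        \sum_i (projT2 (P K') i).1.1 *: (projT2 (P K') i).1.2).
      by rewrite big_pred1_eq; have [_ /(_ Kk)] := HP K.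
    rewrite sig_big_dep /= big_mkcond; apply: eq_bigr => e _ /=.
    by rewrite andbT; case: ifP => //; rewrite scale0r.
have [J [a [col_inj a0 aJ va]]] := colorful_lin dkm Hlin.
(* By injectivity of [col] on [J], at most one index of [J] has colour [i]. *)
pose f i := omap x [pick e in J | col e == i].
exists [set w | exists i, f i = Some w]; split.
  exists f; split => // i w; rewrite /f; case: pickP => //= e /andP[_ /eqP <-].
  by move=> [<-]; have [] := ptP e.
rewrite va; apply: big_ind; first exact: conic_hull0.
  by move=> ? ?; exact: conic_hullD.
move=> e _; have [eJ|/aJ ->] := boolP (e \in J); last first.
  by rewrite scale0r; exact: conic_hull0.
apply: conic_hullZ => //; apply: sub_conic_hull; exists (col e).
rewrite /f; case: pickP => [e' /andP[e'J /eqP ee']|/(_ e)]; last first.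
  by rewrite eJ eqxx.
by rewrite (col_inj _ _ e'J eJ ee').
Qed.

(** * Finite convex combinations, and the convex case by homogenization *)

Lemma convex_set_sum (R : realType) (V : lmodType R) (C : set V) (n : nat)
    (a : 'I_n -> R) (x : 'I_n -> V) :
    convex_set C -> (forall i, 0 <= a i) -> (forall i, C (x i)) ->
  \sum_i a i = 1 -> C (\sum_i a i *: x i).
Proof.
move=> Cconv; elim: n a x => [|n IHn] a x a0 Cx.
  by rewrite big_ord0 => /esym/eqP; rewrite oner_eq0.
rewrite !big_ord_recl /= => sum1.
set s := a ord0 in sum1 *; pose b i := a (lift ord0 i).
have b0 : 0 <= \sum_i b i by apply: sumr_ge0 => i _; exact: a0.
have s0 : 0 <= s by exact: a0.
have [s1|s1] := eqVneq s 1.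
  have /psumr_eq0P bi : \sum_i b i = 0 by move: sum1; rewrite -/b s1; lra.
  rewrite s1 scale1r big1 ?addr0 // => i _.
  by rewrite [a _]bi ?scale0r // => j _; exact: a0.
have s_le1 : s <= 1 by rewrite -sum1 lerDl.
have s_gt0 : 0 < 1 - s by rewrite subr_gt0 lt_neqAle s1.
(* The remaining weights are renormalised to sum to 1, so that induction applies. *)
have Cy : C (\sum_i (b i / (1 - s)) *: x (lift ord0 i)).
  apply: IHn => // [i|]; first by rewrite divr_ge0 ?a0 // ltW.
  rewrite -mulr_suml (_ : \sum_i b i = 1 - s); first by rewrite divff // gt_eqF.
  by rewrite -sum1 addrC addrA addNr add0r.
have := Cconv _ _ (Itv01 s0 s_le1) (mem_set (Cx ord0)) (mem_set Cy).
move/set_mem; congr (C _).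
congr (_ + _); rewrite /= scaler_sumr; apply: eq_bigr => i _.
by rewrite scalerA mulrC divfK // gt_eqF.
Qed.

Section Homogenization.
Context {R : realType} {d : nat}.
Implicit Types (w : 'rV[R]_d) (A : set 'rV[R]_d).

Definition homog w : 'rV[R]_(d + 1) := row_mx w (const_mx 1).

(** The points whose lift lies in the cone form a convex set containing [A]. *)
Lemma conic_hull_homog A w :
  conv_hull A w -> conic_hull (homog @` A) (homog w).
Proof.
move: w.
apply: (@smallest_sub _ _ _ [set w | conic_hull (homog @` A) (homog w)]).
  move=> u w t /set_mem Hu /set_mem Hw; apply/mem_set => /=.
  have -> : homog (conv t u w) = t%:num *: homog u + (1 - t%:num) *: homog w.
    rewrite /homog !scale_row_mx add_row_mx; congr row_mx.
    by apply/matrixP => i j; rewrite !mxE; ring.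
  by apply: conic_hullD; apply: conic_hullZ; rewrite // subr_ge0.
by move=> w Aw; apply: sub_conic_hull; exists w.
Qed.

(** The last coordinate of the conic combination says that its coefficients sum to 1. *)
Lemma conv_hull_homog A B w : B `<=` homog @` A ->
  conic_hull B (homog w) -> conv_hull A w.
Proof.
move=> BA [n [a [y [a0 yB wE]]]] C [Cconv AC].
have /choice[x Hx] i : exists z, A z /\ homog z = y i.
  by have [z Az <-] := BA _ (yB i); exists z.
have -> : w = \sum_i a i *: x i.
  have := congr1 lsubmx wE; rewrite row_mxKl linear_sum => ->.
  by apply: eq_bigr => i _; rewrite -(Hx i).2 /= scale_row_mx row_mxKl.
apply: convex_set_sum => // [i|]; first by apply: AC; have [] := Hx i.
have := congr1 (fun z => rsubmx z 0 0) wE; rewrite row_mxKr mxE => ->.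
rewrite linear_sum summxE; apply: eq_bigr => i _.
by rewrite -(Hx i).2 /= scale_row_mx row_mxKr !mxE mulr1.
Qed.

End Homogenization.

Theorem theorem1p11 (R : realType) (d k : nat) (hd : (1 <= d)%N)
    (hk : (1 <= k)%N) (v : 'rV[R]_d) :
  (forall S : 'I_(d + k) -> set 'rV[R]_d,
     (forall K : {set 'I_(d + k)}, #|K| = k ->
        conv_hull (\bigcup_(i in [set` K]) S i) v) ->
     exists X : set 'rV[R]_d, rainbow_set S X /\ conv_hull X v) /\
  (forall S : 'I_(d + k - 1) -> set 'rV[R]_d,
     (forall K : {set 'I_(d + k - 1)}, #|K| = k ->
        conic_hull (\bigcup_(i in [set` K]) S i) v) ->
     exists X : set 'rV[R]_d, rainbow_set S X /\ conic_hull X v).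
Proof.
split => S HS; last by apply: rainbow_conic_hull HS; lia.
(* The dimension [d + 1] and the [d + k] colours meet the bound with equality. *)
have [||X' [[f [fS ->]] X'v]] := @rainbow_conic_hull R (d + 1) k (d + k)
    (homog v) (fun i => homog @` S i).
- by lia.
- by move=> K /HS /conic_hull_homog; rewrite image_bigcup.
exists [set w | exists i, omap lsubmx (f i) = Some w]; split.
  exists (fun i => omap lsubmx (f i)); split => // i w.
  case fi: (f i) => [y|] //= [<-].
  by have [z Sz <-] := fS _ _ fi; rewrite row_mxKl.
apply: conv_hull_homog X'v => y [i fi].
have [z Sz zy] := fS _ _ fi; exists z => //.
by exists i; rewrite fi -zy /= row_mxKl.
Qed.
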